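(* Let $M\ge 1$ be an integer, let $\beta\in(0,1)$, and let $\mathbf{w}=(w_1,\ldots,w_M)$ be a random vector in $\mathbb{R}^M$. For $m=1,\ldots,M$ let $T_m:[0,\infty)\to\mathbb{R}$ be a function. For $\mathbf{p}_W=(p_{W_1},\ldots,p_{W_M})\in\mathbb{R}^M$ and $\eta\in\mathbb{R}$ define $$F_{\beta}(\mathbf{p}_W,\eta)=\eta+\frac{1}{1-\beta}\,\mathbb{E}_{\mathbf{w}}\left[\left[\sum_{m=1}^M T_m\left([p_{W_m}-w_m]^{+}\right)-\eta\right]^{+}\right].$$ If all the functions $T_1,\ldots,T_M$ are convex and non-decreasing, then $F_{\beta}$ is convex with respect to $(\mathbf{p}_W,\eta)$, i.e. jointly convex on $\mathbb{R}^M\times\mathbb{R}$.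
   Context: For a real number $a$, $[a]^{+}:=\max\{a,0\}$. $\mathbb{E}_{\mathbf{w}}$ denotes expectation with respect to the distribution of $\mathbf{w}$; the expectation of the nonnegative random variable in the definition of $F_\beta$ is understood in $[0,+\infty]$, so $F_\beta$ takes values in $(-\infty,+\infty]$ (real values whenever the expectation is finite), and convexity is meant in the usual sense for such functions. Interpretation: $w_m$ is the actual (random) wind power at bus $m$ of a power grid with $M$ buses, $p_{W_m}$ is the scheduled wind power at bus $m$, $T_m$ is the transaction cost of purchasing the shortfall $[p_{W_m}-w_m]^{+}$, and $F_\beta$ is the auxiliary function associated with the conditional value-at-risk, at probability level $\beta$, of the total transaction cost. *)

(* Defs.v *)
From HB Require Import structures.
From mathcomp Require Import all_boot all_order all_algebra.
From mathcomp Require Import all_classical all_reals all_analysis.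

Set Implicit Arguments.
Unset Strict Implicit.
Unset Printing Implicit Defensive.

Import Order.TTheory GRing.Theory Num.Theory.
Import numFieldNormedType.Exports.

Local Open Scope classical_set_scope.
Local Open Scope ring_scope.
Local Open Scope convex_scope.

(* Analogue, for extended-real-valued functions on the whole space, of the
   library's [convex_function].  It is the usual notion for functions that do
   not take the value -oo: t ranges over [0, 1], and for t = 0 or t = 1 the
   convention 0 * +oo = 0 makes the inequality trivial. *)
Definition econvex_function (R : realType) (E : lmodType R)
    (E' := convex_lmodType E) (f : E' -> \bar R) :=
  forall (t : {i01 R}) (x y : E'),
    (f (x <| t |> y) <= t%:num%:E * f x + (1 - t%:num)%:E * f y)%E.

Local Notation pos_part a := (Num.max a 0%R).

(* [T m] stands for a function on [0, +oo[, extended arbitrarily to R: it is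
   only evaluated at nonnegative arguments. *)
Definition total_cost (R : realType) (M : nat) (T : 'I_M -> R -> R)
    (p : 'rV[R]_M) (w : M.-tuple R) : R :=
  \sum_(m < M) T m (pos_part (p ord0 m - tnth w m)).

(* The integrand is nonnegative, so the expectation is in [0, +oo].
   [M.-tuple R] carries the product of the Borel sigma-algebras of R. *)
Definition cvar_aux (R : realType) (d : measure_display)
    (Omega : measurableType d) (P : probability Omega R) (M : nat)
    (w : {RV P >-> M.-tuple R}) (T : 'I_M -> R -> R) (beta : R)
    (p : 'rV[R]_M) (eta : R) : \bar R :=
  (eta%:E + ((1 - beta)^-1)%:E *
    'E_P[fun omega => (pos_part (total_cost T p (w omega) - eta))%R])%E.

(* Main.v *)
(* For a fixed value of w, each summand is the convex nondecreasing T_m applied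
   to a convex function of p with values in [0, +oo[, hence convex; taking the
   positive part and integrating preserve convexity.  Monotonicity is used a
   second time: it makes the integrand measurable, so that the integral of
   nonnegative functions is additive. *)
Require Import Defs.
From mathcomp Require Import all_boot all_order all_algebra.
From mathcomp Require Import all_classical all_reals all_analysis.
From mathcomp Require Import measurable_realfun lra.

Set Implicit Arguments.
Unset Strict Implicit.
Unset Printing Implicit Defensive.

Import Order.TTheory GRing.Theory Num.Theory.
Import numFieldNormedType.Exports.

Local Open Scope classical_set_scope.
Local Open Scope ring_scope.

Section convex_function_closure.
Context {R : realType} {E : lmodType R}.
Implicit Types (l f : E -> R) (g : E -> \bar R).

Lemma convex_function_sum (I : finType) (F : I -> E -> R) :
  (forall i, convex_function [set: convex_lmodType E] (F i)) ->
  convex_function [set: convex_lmodType E] (fun x => \sum_i F i x).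
Proof.
move=> cF t x y xT yT; rewrite convRE !mulr_sumr -big_split/=.
by apply: ler_sum => i _; exact: cF.
Qed.

(** Since [h] is monotone only on [D], the convex combination of [f x] and [f y] must itself lie in
    [D] before [h] can be compared there; this is what convexity of [D] supplies. *)
Lemma convex_function_comp (D : set R) (h : R -> R) f :
  convex_function (D : set (convex_lmodType R^o)) h ->
  {in D &, nondecreasing_fun h} ->
  convex_set (D : set (convex_lmodType R^o)) ->
  (forall x, f x \in D) ->
  convex_function [set: convex_lmodType E] f ->
  convex_function [set: convex_lmodType E] (h \o f).
Proof.
move=> ch ndh cD fD cf t x y xT yT /=.
apply: le_trans (ch t _ _ (fD x) (fD y)).
by apply: ndh; [exact: fD|apply: cD; exact: fD|exact: cf].
Qed.

Lemma convex_function_posr f :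
  convex_function [set: convex_lmodType E] f ->
  convex_function [set: convex_lmodType E] (fun x => Num.max (f x) 0).
Proof.
move=> cf t x y xT yT; rewrite ge_max; apply/andP; split.
  apply: (le_trans (cf t x y xT yT)); rewrite !convRE.
  by apply: lerD; apply: ler_wpM2l => //;
    rewrite ?unstable.onem_ge0// le_max lexx.
by rewrite convRE addr_ge0 ?mulr_ge0 ?unstable.onem_ge0// le_max lexx orbT.
Qed.

(** This is the outer shape of [cvar_aux]. Infinite values of [g] do no harm: nonnegativity of [g]
    lets [c] distribute over the convex combination. *)
Lemma econvex_function_add_scale l g (c : R) :
  convex_function [set: convex_lmodType E] l -> 0 <= c ->
  (forall x, 0 <= g x)%E -> econvex_function g ->
  econvex_function (fun x => (l x)%:E + c%:E * g x)%E.
Proof.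
move=> cl c0 g0 cg t x y.
have t0 : (0 <= t%:num%:E :> \bar R)%E by rewrite lee_fin.
have s0 : (0 <= (1 - t%:num)%:E :> \bar R)%E.
  by rewrite lee_fin unstable.onem_ge0.
apply: (@le_trans _ _ ((t%:num * l x + (1 - t%:num) * l y)%:E +
    c%:E * (t%:num%:E * g x + (1 - t%:num)%:E * g y))%E).
  apply: leeD; first by rewrite lee_fin; apply: cl; rewrite inE.
  by apply: lee_wpmul2l => //; rewrite lee_fin.
rewrite ge0_muleDr ?mule_ge0//.
rewrite [leRHS](_ : _ = t%:num%:E * (l x)%:E + t%:num%:E * (c%:E * g x) +
   ((1 - t%:num)%:E * (l y)%:E + (1 - t%:num)%:E * (c%:E * g y)))%E; last first.
  (* Distributing the weight requires a well-defined sum, which holds because [l] is real-valued. *)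
  by congr (_ + _)%E; rewrite muleDr// fin_num_adde_defr.
rewrite addeACA EFinD !EFinM.
by rewrite [(c%:E * (t%:num%:E * _))%E]muleCA [(c%:E * (_ * g y))%E]muleCA.
Qed.

End convex_function_closure.

Lemma econvex_expectation (R : realType) (d : measure_display)
    (Omega : measurableType d) (P : probability Omega R) (E : lmodType R)
    (X : E -> Omega -> R) :
  (forall x, measurable_fun [set: Omega] (X x)) ->
  (forall x omega, 0 <= X x omega) ->
  (forall omega, convex_function [set: convex_lmodType E] (X ^~ omega)) ->
  econvex_function (fun x => 'E_P[X x])%E.
Proof.
move=> mX X0 cX t x y; rewrite unlock.
have mEX z : measurable_fun [set: Omega] (EFin \o X z).
  exact/measurable_EFinP.
have mZX (k : R) z : measurable_fun [set: Omega] (fun o => k%:E * (X z o)%:E)%E.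
  by apply: measurable_funeM; exact: mEX.
have s0 : 0 <= 1 - t%:num by exact: unstable.onem_ge0.
have X0e z o : [set: Omega] o -> (0 <= (X z o)%:E)%E by rewrite lee_fin.
have ZX0 (k : R) z o : 0 <= k -> [set: Omega] o -> (0 <= k%:E * (X z o)%:E)%E.
  by move=> k0 _; rewrite mule_ge0 ?lee_fin.
(* The right-hand side is gathered into one integral, which reduces the claim to a pointwise
   inequality. Nonnegativity replaces integrability, so infinite expectations are covered. *)
rewrite -!(ge0_integralZl_EFin _ _ _ (mEX _))//; try exact: X0e.
rewrite -ge0_integralD//; try by [exact: mZX | move=> o; exact: ZX0].
apply: ge0_le_integral => //.
- exact: X0e.
- exact: mEX.
- by apply: emeasurable_funD; exact: mZX.
- by move=> o _; rewrite -!EFinM -EFinD lee_fin; apply: cX; rewrite inE.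
Qed.

Lemma convex_set_itvcy (R : realType) (a : R) :
  convex_set (`[a, +oo[%classic : set (convex_lmodType R^o)).
Proof.
move=> x y t; rewrite !inE/= !in_itv/= !andbT => ax ay.
(* Seen as its own convex combination, [a] is compared with the right-hand side term by term. *)
rewrite -(convmm t (a : convex_lmodType R^o)).
by apply: lerD; apply: ler_wpM2l => //; rewrite unstable.onem_ge0.
Qed.

Section total_cost_lemmas.
Context {R : realType} {M : nat}.
Implicit Types T : 'I_M -> R -> R.

(** [T m] is arbitrary on negative arguments and may fail to be measurable, but precomposed with the
    positive part it is nondecreasing on all of [R], hence Borel. *)
Lemma measurable_total_cost T (p : 'rV[R]_M) :
  (forall m, {in `[0, +oo[ &, nondecreasing_fun (T m)}) ->
  measurable_fun [set: M.-tuple R] (total_cost T p).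
Proof.
move=> Tnondecr; apply: measurable_sum => m.
have mT : measurable_fun [set: R] (fun a => T m (Num.max a 0)).
  apply: nondecreasing_measurable => // a b ab; apply: Tnondecr.
  - by rewrite in_itv/= andbT le_max lexx orbT.
  - by rewrite in_itv/= andbT le_max lexx orbT.
  - by rewrite ge_max !le_max ab lexx orbT.
apply: (measurableT_comp mT).
by apply: measurable_funB => //; exact: measurable_tnth.
Qed.

Lemma convex_total_cost T (w : M.-tuple R) :
  (forall m, convex_function (`[0, +oo[%classic : set R) (T m)) ->
  (forall m, {in `[0, +oo[ &, nondecreasing_fun (T m)}) ->
  convex_function [set: convex_lmodType 'rV[R]_M] (total_cost T ^~ w).
Proof.
move=> Tconvex Tnondecr; apply: convex_function_sum => m.
apply: (@convex_function_comp _ _ `[0, +oo[%classic (T m)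
  (fun p : 'rV[R]_M => Num.max (p ord0 m - tnth w m) 0)) => //.
- by move=> x y; rewrite !inE; exact: Tnondecr.
- exact: convex_set_itvcy.
- by move=> p; rewrite inE/= in_itv/= andbT le_max lexx orbT.
- apply: convex_function_posr => t p q _ _.
  (* Equality holds here: the map is affine in [p], the weights summing to 1. *)
  by rewrite convRE !mxE /unstable.onem; lra.
Qed.

End total_cost_lemmas.

Theorem proposition1 (R : realType) (d : measure_display)
    (Omega : measurableType d) (P : probability Omega R)
    (M : nat) (hM : (1 <= M)%N) (beta : R) (hbeta : 0 < beta < 1)
    (w : {RV P >-> M.-tuple R}) (T : 'I_M -> R -> R)
    (Tconvex : forall m : 'I_M,
       convex_function (`[0, +oo[%classic : set R) (T m))
    (Tnondecr : forall m : 'I_M,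
       {in `[0, +oo[ &, nondecreasing_fun (T m)}) :
  @econvex_function R ('rV[R]_M * R^o)%type
    (fun x => cvar_aux w T beta x.1 x.2).
Proof.
have c0 : 0 <= (1 - beta)^-1.
  by case/andP: hbeta => _ b1; rewrite invr_ge0 subr_ge0 ltW.
(* The finite summand is the coordinate [eta], which is linear in the pair. *)
apply: (econvex_function_add_scale (l := snd)) => //.
- by move=> t x y _ _; rewrite convRE.
- by move=> x; apply: expectation_ge0 => o; rewrite le_max lexx orbT.
- apply: econvex_expectation => [x|x o|o].
  + apply: measurable_maxr => //; apply: measurable_funB => //.
    by apply: measurableT_comp => //; exact: measurable_total_cost.
  + by rewrite le_max lexx orbT.
  + apply: convex_function_posr => t x y _ _.
    have := convex_total_cost (w o) Tconvex Tnondecr t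
      (in_setT x.1) (in_setT y.1).
    (* Joint convexity comes from linearity in [eta]: after regrouping, both sides subtract the same
       combination of [x.2] and [y.2], leaving the inequality for the cost in [p] alone. *)
    rewrite !convRE !mulrBr addrACA -opprD => le_cost.
    exact: lerB le_cost _.
Qed.
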